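(* Let $G/H$ be a homogeneous space and let $g$ be a $G$-invariant pseudo-Riemannian metric (of arbitrary signature) on $G/H$. If $g$ is not invariantly rigid, then $g$ does not have full holonomy algebra, i.e. for $p\in G/H$ the holonomy algebra $hol_p(g)$ of the Levi-Civita connection of $g$ is not equal to $so(T_p(G/H),g_p)$.
   Context: A homogeneous space $G/H$ is the quotient of a Lie group $G$ by a closed subgroup $H$, with $G$ acting transitively by left translations; all manifolds are assumed connected and of dimension $n\ge 2$. A metric is a smooth Riemannian or pseudo-Riemannian metric of arbitrary signature; it is $G$-invariant if $G$ acts on $G/H$ by isometries. Two metrics are affinely equivalent if their Levi-Civita connections coincide. A $G$-invariant metric $g$ on $G/H$ is called invariantly rigid if the only $G$-invariant metrics on $G/H$ affinely equivalent to $g$ are the metrics $\lambda g$ with a constant $\lambda\neq 0$. For $p \in G/H$, $so(T_p(G/H),g_p)$ denotes the Lie algebra of endomorphisms of $T_p(G/H)$ that are skew-symmetric with respect to $g_p$; the holonomy algebra of $g$ at $p$ is always contained in it and is called full if equality holds. *)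

(* Defs.v *)
From HB Require Import structures.
From mathcomp Require Import all_boot all_order all_algebra.
From mathcomp Require Import all_classical all_reals all_analysis.
From mathcomp Require Import ring.

Set Implicit Arguments.
Unset Strict Implicit.
Unset Printing Implicit Defensive.

Import Order.TTheory GRing.Theory Num.Theory.
Import numFieldNormedType.Exports.

Local Open Scope classical_set_scope.
Local Open Scope ring_scope.
Local Open Scope quotient_scope.

Section SmoothMaps.
Context {R : realType} {V W : normedModType R}.

Fixpoint iter_derive (vs : seq V) (f : V -> W) : V -> W :=
  if vs is v :: vs' then 'D_v (iter_derive vs' f) else f.

(* C^oo on an open set U: all iterated directional derivatives of f are
   differentiable at every point of U. *)
Definition smooth_on (U : set V) (f : V -> W) : Prop :=
  forall (vs : seq V) (x : V), U x -> differentiable (iter_derive vs f) x.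

End SmoothMaps.

(* The maps chart_map c and chart_inv c are total; their values are meaningful only on
   chart_dom c and on its image under chart_map c, where they are mutually inverse. *)
Record atlas (R : realType) (n : nat) (M : topologicalType) := Atlas {
  chart : Type;
  chart_dom : chart -> set M;
  chart_map : chart -> M -> 'rV[R]_n;
  chart_inv : chart -> 'rV[R]_n -> M
}.

Arguments Atlas {R n M chart} chart_dom chart_map chart_inv.
Arguments chart_dom {R n M} a c.
Arguments chart_map {R n M} a c.
Arguments chart_inv {R n M} a c.

Section Manifolds.
Context {R : realType}.

Definition chart_image {n} {M : topologicalType} (A : atlas R n M) (c : chart A) :
  set 'rV[R]_n := chart_map A c @` chart_dom A c.

Arguments chart_image {n M} A c.

Record manifold n (M : topologicalType) (A : atlas R n M) : Prop := Manifold {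
  manifold_hausdorff : hausdorff_space M;
  manifold_second_countable : @second_countable M;
  chart_dom_cover : forall p, exists c, chart_dom A c p;
  chart_dom_open : forall c, open (chart_dom A c);
  chart_image_open : forall c, open (chart_image A c);
  chart_mapK : forall c p, chart_dom A c p -> chart_inv A c (chart_map A c p) = p;
  chart_map_continuous : forall c p, chart_dom A c p -> {for p, continuous (chart_map A c)};
  chart_inv_continuous : forall c x, chart_image A c x -> {for x, continuous (chart_inv A c)};
  transition_smooth : forall c d,
    smooth_on (chart_map A c @` (chart_dom A c `&` chart_dom A d)) (chart_map A d \o chart_inv A c)
}.

(* Smoothness, on an open subset U of a normed space, of a map into a manifold. *)
Definition smooth_into (V : normedModType R) n (M : topologicalType)
    (A : atlas R n M) (U : set V) (f : V -> M) : Prop :=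
  (forall x, U x -> {for x, continuous f}) /\
  (forall c, smooth_on (U `&` f @^-1` chart_dom A c) (chart_map A c \o f)).

Definition smooth_map m n (M N : topologicalType)
    (A : atlas R m M) (B : atlas R n N) (f : M -> N) : Prop :=
  forall c, smooth_into B (chart_image A c) (f \o chart_inv A c).

Definition prod_atlas m n (M N : topologicalType)
    (A : atlas R m M) (B : atlas R n N) : atlas R (m + n) (M * N)%type :=
  @Atlas R (m + n) (M * N)%type (chart A * chart B)%type
    (fun c => chart_dom A c.1 `*` chart_dom B c.2)
    (fun c p => row_mx (chart_map A c.1 p.1) (chart_map B c.2 p.2))
    (fun c x => (chart_inv A c.1 (lsubmx x), chart_inv B c.2 (rsubmx x))).

(* The differential of f at p in the coordinates c (at p) and d (at f p).
   Tangent vectors are row vectors of components, on which the Jacobian 'J acts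
   by right multiplication: v |-> v *m tangent_mx A B c d f p. *)
Definition tangent_mx m n (M N : topologicalType)
    (A : atlas R m M) (B : atlas R n N) (c : chart A) (d : chart B)
    (f : M -> N) (p : M) : 'M[R]_(m, n) :=
  'J (chart_map B d \o f \o chart_inv A c) (chart_map A c p).

Definition submersion m n (M N : topologicalType)
    (A : atlas R m M) (B : atlas R n N) (f : M -> N) : Prop :=
  smooth_map A B f /\
  forall c d p, chart_dom A c p -> chart_dom B d (f p) -> row_full (tangent_mx c d f p).

End Manifolds.

Arguments chart_image {R n M} A c.

#[short(type="topGroupType")]
HB.structure Definition TopGroup := {G of Topological G & Group G}.

Definition lie_group (R : realType) m (G : topGroupType) (A : atlas R m G) : Prop :=
  [/\ manifold A,
      smooth_map (prod_atlas A A) A (fun xy : G * G => (xy.1 * xy.2)%g) &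
      smooth_map A A (fun x : G => (x^-1)%g)].

Record closed_subgroup (G : topGroupType) := ClosedSubgroup {
  subgroup_set :> set G;
  subgroup1 : subgroup_set 1%g;
  subgroupM : forall x y, subgroup_set x -> subgroup_set y -> subgroup_set (x * y)%g;
  subgroupV : forall x, subgroup_set x -> subgroup_set (x^-1)%g;
  subgroup_closed : closed subgroup_set
}.

Section CosetSpace.
Context {G : topGroupType} (H : closed_subgroup G).

Definition coset_rel (x y : G) : bool := `[< subgroup_set H (x^-1 * y)%g >].

Lemma coset_rel_refl : reflexive coset_rel.
Proof. by move=> x; apply/asboolP; rewrite mulVg; exact: subgroup1. Qed.

Lemma coset_rel_sym : symmetric coset_rel.
Proof.
suff imp x y : coset_rel x y -> coset_rel y x by move=> x y; apply/idP/idP; exact: imp.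
by move=> /asboolP/subgroupV; rewrite invgM invgK => ?; exact/asboolP.
Qed.

Lemma coset_rel_trans : transitive coset_rel.
Proof.
move=> y x z /asboolP Hxy /asboolP Hyz; apply/asboolP.
by have := subgroupM Hxy Hyz; rewrite mulgA mulgK.
Qed.

Canonical coset_equiv :=
  EquivRel coset_rel coset_rel_refl coset_rel_sym coset_rel_trans.

Definition coset_space := quotient_topology {eq_quot coset_equiv}.

HB.instance Definition _ := Topological.on coset_space.
HB.instance Definition _ := Quotient.on coset_space.

Definition coset_proj (x : G) : coset_space := \pi_coset_space x.

Definition translation (a : G) (p : coset_space) : coset_space :=
  coset_proj (a * repr p)%g.

Lemma translation_proj a x : translation a (coset_proj x) = coset_proj (a * x)%g.
Proof.
rewrite /translation /coset_proj; apply/eqmodP => /=.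
have /eqmodP/asboolP : repr (coset_proj x) = x %[mod coset_space].
  by rewrite reprK.
move=> h; apply/asboolP; congr (subgroup_set H _): h.
by rewrite invgM -mulgA mulKg.
Qed.

End CosetSpace.

(* The smooth structure of G/H is the unique one for which the canonical
   projection from G is a submersion. *)
Definition homogeneous_space (R : realType) m n (G : topGroupType)
    (AG : atlas R m G) (H : closed_subgroup G) (A : atlas R n (coset_space H)) : Prop :=
  [/\ lie_group AG, manifold A & submersion AG A (@coset_proj G H)].

Section MetricGeometry.
Context {R : realType} {n : nat} {M : topologicalType} (A : atlas R n M).

(* g c p is the Gram matrix at p of the coordinate frame of the chart c. *)
Definition bilinear_field := chart A -> M -> 'M[R]_n.

Definition field_pairing (g : bilinear_field) c p (u v : 'rV[R]_n) : R :=
  (u *m g c p *m v^T) 0 0.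

(* No positivity is required: the signature is arbitrary. *)
Record pseudo_riemannian (g : bilinear_field) : Prop := PseudoRiemannian {
  metric_symmetric : forall c p, chart_dom A c p -> (g c p)^T = g c p;
  metric_nondegenerate : forall c p, chart_dom A c p -> g c p \in unitmx;
  metric_change : forall c d p, chart_dom A c p -> chart_dom A d p -> forall u v,
    field_pairing g c p u v =
    field_pairing g d p (u *m tangent_mx c d id p) (v *m tangent_mx c d id p);
  metric_smooth : forall c, smooth_on (chart_image A c) (g c \o chart_inv A c)
}.

Definition preserves_metric (g : bilinear_field) (f : M -> M) : Prop :=
  forall c d p, chart_dom A c p -> chart_dom A d (f p) -> forall u v,
    field_pairing g c p u v =
    field_pairing g d (f p) (u *m tangent_mx c d f p) (v *m tangent_mx c d f p).

Definition partial (g : bilinear_field) c p (i : 'I_n) : 'M[R]_n :=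
  'D_(delta_mx 0 i) (g c \o chart_inv A c) (chart_map A c p).

(* Levi-Civita connection: the Christoffel symbol Gamma^k_ij at p in the chart c. *)
Definition christoffel (g : bilinear_field) c p (k i j : 'I_n) : R :=
  2^-1 * \sum_l invmx (g c p) k l *
    (partial g c p i j l + partial g c p j i l - partial g c p l i j).

Lemma partial_symmetric (g : bilinear_field) c p i j l :
  manifold A -> pseudo_riemannian g -> chart_dom A c p ->
  partial g c p i j l = partial g c p i l j.
Proof.
move=> mA mg cp; rewrite /partial.
set x := chart_map A c p; set f := g c \o chart_inv A c.
have imx : chart_image A c x by exists p.
have df : derivable f x (delta_mx 0 i).
  by apply: diff_derivable; exact: (metric_smooth mg [::] imx).
rewrite derive_mx // !mxE; apply: near_eq_derive.
have : nbhs x (chart_image A c).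
  by apply: open_nbhs_nbhs; split => //; exact: chart_image_open.
apply: filterS => _ [q cq <-]; rewrite /f /= (chart_mapK mA cq).
by rewrite -[in LHS](metric_symmetric mg cq) mxE.
Qed.

(* christoffel g c p is characterized by the vanishing of the torsion and of the
   covariant derivative of g. *)
Lemma christoffelP (g : bilinear_field) c p (Gam : 'I_n -> 'I_n -> 'I_n -> R) :
  manifold A -> pseudo_riemannian g -> chart_dom A c p ->
  Gam = christoffel g c p <->
  (forall k i j, Gam k i j = Gam k j i) /\
  (forall i j l, partial g c p i j l =
     \sum_k (Gam k i j * g c p k l + Gam k i l * g c p j k)).
Proof.
move=> mA mg cp.
have gsym j k : g c p j k = g c p k j.
  by rewrite -[in LHS](metric_symmetric mg cp) mxE.
have gV := metric_nondegenerate mg cp.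
have Psym i j l := partial_symmetric i j l mA mg cp.
pose low (Ga : 'I_n -> 'I_n -> 'I_n -> R) i j l := \sum_k Ga k i j * g c p k l.
pose K i j l := 2^-1 *
  (partial g c p i j l + partial g c p j i l - partial g c p l i j).
have raise Ga i j : (forall l, low Ga i j l = K i j l) <->
    (forall k, Ga k i j = christoffel g c p k i j).
  have chE : (\row_k christoffel g c p k i j) = (\row_l K i j l) *m invmx (g c p).
    apply/rowP => k; rewrite !mxE /christoffel mulr_sumr; apply: eq_bigr => l _.
    rewrite mxE mulrCA mulrC; congr (_ * _).
    have : (invmx (g c p))^T = invmx (g c p).
      by rewrite trmx_inv (metric_symmetric mg cp).
    by move=> /matrixP/(_ k l); rewrite mxE => <-.
  have lowE : (\row_l low Ga i j l) = (\row_k Ga k i j) *m g c p.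
    by apply/rowP => l; rewrite !mxE; apply: eq_bigr => k _; rewrite mxE.
  split=> E.
    have rE : (\row_l low Ga i j l) = \row_l K i j l.
      by apply/rowP => l; rewrite !mxE.
    move: chE; rewrite -rE lowE mulmxK // => /rowP chE k.
    by have := chE k; rewrite !mxE.
  move: lowE; have -> : (\row_k Ga k i j) = \row_k christoffel g c p k i j.
    by apply/rowP => k; rewrite !mxE.
  by rewrite chE mulmxKV // => /rowP lowE l; have := lowE l; rewrite !mxE.
have mE Ga i j l : \sum_k (Ga k i j * g c p k l + Ga k i l * g c p j k) =
    low Ga i j l + low Ga i l j.
  by rewrite big_split; congr (_ + _); apply: eq_bigr => k _; rewrite (gsym j).
split=> [-> | [tf mc]].
  have lowK i j : forall l, low (christoffel g c p) i j l = K i j l by apply/raise.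
  split=> [k i j|i j l].
    rewrite /christoffel; congr (_ * _); apply: eq_bigr => l _.
    by rewrite (Psym l i j) [X in X - _]addrC.
  rewrite mE !lowK /K (Psym i l j).
  by field.
apply/funext => k; apply/funext => i; apply/funext => j; move: k.
apply/raise => l.
have tl a b d : low Gam a b d = low Gam b a d.
  by apply: eq_bigr => k _; rewrite tf.
rewrite /K !mc !mE (tl j i l) (tl l i j) (tl l j i).
by field.
Qed.

Definition affinely_equivalent (g h : bilinear_field) : Prop :=
  forall c p, chart_dom A c p -> christoffel g c p = christoffel h c p.

Definition christoffel_form (g : bilinear_field) c p (u v : 'rV[R]_n) : 'rV[R]_n :=
  \row_k \sum_i \sum_j christoffel g c p k i j * u 0 i * v 0 j.

Definition subdivision (k : nat) (t : nat -> R) : Prop :=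
  [/\ t 0%N = 0, t k = 1 & forall i, (i < k)%N -> t i < t i.+1].

(* On each closed subinterval the curve is the restriction of a smooth curve
   defined on an open neighbourhood. *)
Definition piecewise_smooth (k : nat) (t : nat -> R) (gam : R -> M) : Prop :=
  forall i, (i < k)%N -> exists (U : set R) (sigma : R -> M),
    [/\ open U, `[t i, t i.+1] `<=` U, smooth_into A U sigma &
        forall s, s \in `[t i, t i.+1] -> gam s = sigma s].

(* V c s is the component vector at time s, in the chart c, of a vector field
   along gam; it is meaningful when gam s lies in chart_dom c. *)
Record parallel (g : bilinear_field) (k : nat) (t : nat -> R) (gam : R -> M)
    (V : chart A -> R -> 'rV[R]_n) : Prop := Parallel {
  parallel_change : forall c d (s : R), s \in `[0, 1] ->
    chart_dom A c (gam s) -> chart_dom A d (gam s) ->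
    V d s = V c s *m tangent_mx c d id (gam s);
  parallel_continuous : forall c,
    {within `[0, 1] `&` gam @^-1` chart_dom A c, continuous (V c)};
  parallel_eq : forall i c (s : R), (i < k)%N -> s \in `]t i, t i.+1[ ->
    chart_dom A c (gam s) ->
    is_derive s 1 (V c) (- christoffel_form g c (gam s)
                             ('D_1 (chart_map A c \o gam) s) (V c s))
}.

(* The holonomy group at p, as matrices acting on the right on the components in
   the chart c (which is to contain p) of the tangent vectors at p. *)
Definition holonomy_group (g : bilinear_field) c p : set 'M[R]_n :=
  [set P | exists k t gam,
    [/\ subdivision k t, piecewise_smooth k t gam, gam 0 = p, gam 1 = p &
        forall v, exists V, [/\ parallel g k t gam V, V c 0 = v & V c 1 = v *m P]]].

(* The Lie algebra of the holonomy group: the generators of the one-parameter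
   subgroups of GL(T_p M) contained in it. *)
Definition holonomy_algebra (g : bilinear_field) c p : set 'M[R]_n :=
  [set X | exists a : R -> 'M[R]_n,
    [/\ a 0 = 1%:M, forall s t : R, a (s + t) = a s *m a t, is_derive (0 : R) 1 a X &
        forall t, holonomy_group g c p (a t)]].

Definition so_algebra (g : bilinear_field) c p : set 'M[R]_n :=
  [set X | forall u v,
    field_pairing g c p (u *m X) v = - field_pairing g c p u (v *m X)].

End MetricGeometry.

Section Invariance.
Context {R : realType} {n : nat} {G : topGroupType} {H : closed_subgroup G}.
Variable A : atlas R n (coset_space H).

Definition G_invariant (g : bilinear_field A) : Prop :=
  forall a : G, preserves_metric g (translation a).

Definition invariantly_rigid (g : bilinear_field A) : Prop :=
  forall h : bilinear_field A,
    pseudo_riemannian h -> G_invariant h -> affinely_equivalent g h ->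
    exists2 lam : R, lam != 0 &
      forall c p, chart_dom A c p -> h c p = lam *: g c p.

End Invariance.

(* Main.v *)
Require Import Defs.
From mathcomp Require Import all_boot all_order all_algebra.
From mathcomp Require Import all_classical all_reals all_analysis.
From mathcomp Require Import ring.

Import Order.TTheory GRing.Theory Num.Theory.
Import numFieldNormedType.Exports.

Set Implicit Arguments.
Unset Strict Implicit.
Unset Printing Implicit Defensive.

Local Open Scope classical_set_scope.
Local Open Scope ring_scope.

(** Suppose that the holonomy algebra of [g] at [p] is all of so(g_p), and let
    [h] be an invariant metric with the same Levi-Civita connection as [g]; it
    has to be shown that [h] is a constant multiple of [g].

    The metric [h] is parallel for its own connection, hence for that of [g], so
    every parallel transport of [g] around a loop at [p] is an isometry of h_p
    ([holonomy_group_isometry]). A one-parameter group of such isometries has a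
    generator that is skew with respect to h_p ([stabilizer_generator]).
    Therefore every X that is skew for g_p is skew for h_p.

    This is enough to make h_p proportional to g_p ([so_invariant_form]): the
    g_p-skew matrices are the S g^-1 with S antisymmetric, and B := g^-1 h then
    satisfies S B = B^T S for all antisymmetric S, which forces B to be scalar.
    This works alike in every dimension and signature, including so(1,1), whose
    action is reducible, so that Schur's lemma does not apply to it.

    Finally the relation h_p = a g_p spreads to the whole space with the same
    constant [a], because the translations act transitively and pull back both
    metrics ([invariant_proportional]).

    Tangent vectors are row vectors, so a bilinear form h is transformed by P
    into P h P^T, and X is skew for h when X h + h X^T = 0. *)

(** * Symmetric forms invariant under an orthogonal Lie algebra *)

Section LinearAlgebra.
Context {F : numFieldType} {n : nat}.
Implicit Types (B S X g h : 'M[F]_n).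

(** It suffices to test the elementary antisymmetric matrices E_ij - E_ji: the
    entry (i, j) of the relation says that B_jj = B_ii, the entry (i, i) that
    B_ji = - B_ji. *)
Lemma skew_intertwiner_scalar B :
  (forall S, S^T = - S -> S *m B = B^T *m S) -> exists a, B = a%:M.
Proof.
move=> Bskew; suff /is_scalar_mxP : is_scalar_mx B by [].
pose S (i j : 'I_n) : 'M[F]_n := delta_mx i j - delta_mx j i.
have SB (i j k l : 'I_n) : (S i j *m B) k l = (k == i)%:R * B j l - (k == j)%:R * B i l.
  by rewrite /S mulmxBl !mxE; congr (_ - _); [rewrite (bigD1 j) | rewrite (bigD1 i)] => //=;
    rewrite big1 ?addr0 ?mxE ?eqxx ?andbT // => q /negPf qj; rewrite !mxE qj andbF mul0r.
have BS (i j k l : 'I_n) : (B^T *m S i j) k l = B i k * (l == j)%:R - B j k * (l == i)%:R.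
  by rewrite /S mulmxBr !mxE; congr (_ - _); [rewrite (bigD1 i) | rewrite (bigD1 j)] => //=;
    rewrite big1 ?addr0 ?mxE ?eqxx //= => q /negPf qj; rewrite !mxE qj /= mulr0.
have E i j k l : (k == i)%:R * B j l - (k == j)%:R * B i l =
    B i k * (l == j)%:R - B j k * (l == i)%:R.
  by rewrite -SB -BS Bskew // /S linearB /= !trmx_delta opprB.
case: n B S Bskew SB BS E => [|n'] B S _ _ _ E; apply/is_scalar_mxP.
  by exists 0; apply/matrixP => -[].
exists (B ord0 ord0); apply/matrixP => i j; rewrite !mxE.
have [<-|ij] := eqVneq i j.
  have [->//|i0] := eqVneq i ord0.
  have := E ord0 i ord0 i; rewrite !eqxx (negPf i0) eq_sym (negPf i0).
  by rewrite mul1r !mulr0 mul0r mulr1 !subr0.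
have := E j i j j; rewrite !eqxx eq_sym (negPf ij) mul1r mul0r mulr0 mulr1 sub0r subr0.
by move=> /eqP; rewrite -addr_eq0 -mulr2n mulrn_eq0 => /eqP.
Qed.

(** The matrix g^-1 h intertwines every antisymmetric S with its transpose: apply
    the hypothesis to X = S g^-1, which is skew for g. *)
Lemma so_invariant_form g h : g^T = g -> h^T = h -> g \in unitmx ->
  (forall X, X *m g + g *m X^T = 0 -> X *m h + h *m X^T = 0) ->
  exists a, h = a *: g.
Proof.
move=> gs hs gu inv.
have gis : (invmx g)^T = invmx g by rewrite trmx_inv gs.
have [S Ssk|a Ba] := @skew_intertwiner_scalar (invmx g *m h).
  have := inv (S *m invmx g); rewrite mulmxKV // trmx_mul gis mulKVmx // Ssk subrr.
  move=> /(_ erefl) /eqP; rewrite mulmxN mulmxN subr_eq0 trmx_mul gis hs !mulmxA.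
  by move=> /eqP.
by exists a; rewrite -[h](mulKVmx gu) Ba mul_mx_scalar.
Qed.
End LinearAlgebra.

(** * Derivatives of matrix-valued maps *)

Section MatrixCalculus.
Context {R : realType} {V : normedModType R}.

Lemma is_derive_mxP {m n} (M : V -> 'M[R]_(m, n)) dM x v :
  is_derive x v M dM <-> forall i j, is_derive x v (fun t => M t i j) (dM i j).
Proof.
split=> [[Mx <-] i j|ent].
  by rewrite derive_mx // mxE; apply: DeriveDef => //; move/derivable_mxP : Mx; exact.
have Mx : derivable M x v by apply/derivable_mxP => i j; case: (ent i j).
apply: DeriveDef => //; rewrite derive_mx //; apply/matrixP => i j.
by rewrite mxE; case: (ent i j).
Qed.

Lemma is_derive_mulmx {m n q} (M : V -> 'M[R]_(m, n)) (N : V -> 'M[R]_(n, q))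
    dM dN x v :
  is_derive x v M dM -> is_derive x v N dN ->
  is_derive x v (fun t => M t *m N t) (M x *m dN + dM *m N x).
Proof.
move=> /is_derive_mxP MdM /is_derive_mxP NdN; apply/is_derive_mxP => i j.
have MN k := is_deriveM (MdM i k) (NdN k j).
have := is_derive_sum MN; rewrite !mxE.
move=> /is_derive_eq; rewrite -big_split /=.
set f := (X in is_derive x v X) => fd.
rewrite (_ : (fun t => _) = f); last first.
  by apply/funext => t; rewrite /f fct_sumE mxE.
by apply: fd; apply: eq_bigr => k _; congr (_ + _); rewrite mulrC.
Qed.

Lemma is_derive_trmx {m n} (M : V -> 'M[R]_(m, n)) dM x v :
  is_derive x v M dM -> is_derive x v (fun t => (M t)^T) dM^T.
Proof.
move=> /is_derive_mxP MdM; apply/is_derive_mxP => i j.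
by under eq_fun do rewrite mxE; rewrite mxE.
Qed.
End MatrixCalculus.

(** Differentiate the constant a(t) h a(t)^T at t = 0. *)
Lemma stabilizer_generator {R : realType} {n} (h X : 'M[R]_n) (a : R -> 'M[R]_n) :
  a 0 = 1%:M -> is_derive (0 : R) 1 a X -> (forall t, a t *m h *m (a t)^T = h) ->
  X *m h + h *m X^T = 0.
Proof.
move=> a0 aX ah.
have hd : is_derive (0 : R) 1 (fun=> h) 0 by exact: is_derive_cst.
have [] := is_derive_mulmx (is_derive_mulmx aX hd) (is_derive_trmx aX).
under eq_fun do rewrite ah.
by rewrite derive_cst a0 trmx1 mul1mx mulmx1 mul1mx add0r addrC => _ /esym.
Qed.

(** * The metric along a curve *)

Section MetricAlongCurves.
Context {R : realType} {n : nat} {M : topologicalType} {A : atlas R n M}.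
Implicit Types (g h : bilinear_field A) (c d : chart A) (gam : R -> M).

(** The connection form of [g] evaluated on the tangent vector [w], as a matrix
    acting on the right: it turns the equation of parallel transport along a
    curve with velocity w into V' = - V * connection_mx. *)
Definition connection_mx g c p (w : 'rV[R]_n) : 'M[R]_n :=
  \matrix_(j, k) \sum_i christoffel g c p k i j * w 0 i.

Lemma christoffel_formE g c p (u v : 'rV[R]_n) :
  christoffel_form g c p u v = v *m connection_mx g c p u.
Proof.
apply/rowP => k; rewrite !mxE exchange_big; apply: eq_bigr => j _.
by rewrite !mxE mulrC mulr_suml.
Qed.

(** The vanishing of the covariant derivative of [g], in matrix form: the left
    side is the derivative of the Gram matrix in the direction [w]. *)
Lemma connection_mx_compatible g c p (w : 'rV[R]_n) :
  manifold A -> pseudo_riemannian g -> chart_dom A c p ->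
  \sum_i w 0 i *: partial g c p i =
  connection_mx g c p w *m g c p + g c p *m (connection_mx g c p w)^T.
Proof.
move=> mA mg cp; have [_ dg] := (christoffelP _ mA mg cp).1 erefl.
apply/matrixP => j l; rewrite !mxE summxE -big_split /=.
under eq_bigr => i _ do rewrite mxE dg mulr_sumr.
rewrite exchange_big /=; apply: eq_bigr => k _.
rewrite !mxE mulr_suml mulr_sumr -big_split; apply: eq_bigr => i _ /=.
by ring.
Qed.

Lemma gram_continuous g c p : manifold A -> pseudo_riemannian g ->
  chart_dom A c p -> {for p, continuous (g c)}.
Proof.
move=> mA mg cp.
have ci : chart_image A c (chart_map A c p) by exists p.
have gK : {near nbhs p, (g c \o chart_inv A c) \o chart_map A c =1 g c}.
  apply: filterS (open_nbhs_nbhs (conj (chart_dom_open mA c) cp)) => q cq /=.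
  by rewrite (chart_mapK mA cq).
apply: cvg_trans (near_eq_cvg gK) _.
have : {for p, continuous ((g c \o chart_inv A c) \o chart_map A c)}.
  apply: continuous_comp (chart_map_continuous mA cp) _.
  exact: differentiable_continuous (metric_smooth mg [::] ci).
rewrite /prop_for /continuous_at /= (chart_mapK mA cp); exact.
Qed.

(** The chain rule, through the coordinate expression of [g] in the chart [c]. *)
Lemma is_derive_gram_along g c gam s : manifold A -> pseudo_riemannian g ->
  chart_dom A c (gam s) -> {for s, continuous gam} ->
  differentiable (chart_map A c \o gam) s ->
  is_derive s 1 (fun r => g c (gam r))
    (\sum_i ('D_1 (chart_map A c \o gam) s) 0 i *: partial g c (gam s) i).
Proof.
move=> mA mg cs gc dgam.
have ci : chart_image A c ((chart_map A c \o gam) s) by exists (gam s).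
have dg : differentiable (g c \o chart_inv A c) ((chart_map A c \o gam) s).
  exact: (metric_smooth mg [::] ci).
apply: (@near_eq_is_derive _ _ _ ((g c \o chart_inv A c) \o (chart_map A c \o gam))).
  have near_dom : \forall r \near s, chart_dom A c (gam r).
    by apply: gc; apply: open_nbhs_nbhs; split => //; exact: chart_dom_open.
  apply: filterS near_dom => r cr /=.
  by rewrite (chart_mapK mA cr).
have dcomp := differentiable_comp dgam dg.
apply: DeriveDef; first exact: diff_derivable.
rewrite deriveE // diff_comp //= -(deriveE (1 : R) dgam).
rewrite [X in 'd _ _ X](row_sum_delta ('D_1 _ s)) linear_sum.
apply: eq_bigr => i _ /=; rewrite linearZ /=; congr (_ *: _).
by rewrite /partial -deriveE.
Qed.

Lemma field_pairing_cvg (T : Type) (F : set_system T) (FF : Filter F) h c p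
    (q : T -> M) (u v : T -> 'rV[R]_n) (u0 v0 : 'rV[R]_n) :
  (fun r => h c (q r)) @ F --> h c p -> u @ F --> u0 -> v @ F --> v0 ->
  (fun r => field_pairing h c (q r) (u r) (v r)) @ F --> field_pairing h c p u0 v0.
Proof.
move=> hq uq vq; rewrite /field_pairing.
have ent m k (N : T -> 'M[R]_(m, k)) (N0 : 'M[R]_(m, k)) i j : N @ F --> N0 ->
    (fun r => N r i j) @ F --> N0 i j.
  by move=> NN0; exact: (cvg_comp _ _ NN0 (@coord_continuous _ _ _ i j N0)).
have pairE q' u' v' : (u' *m h c q' *m v'^T) 0 0 =
    \sum_j (\sum_i u' 0 i * h c q' i j) * v' 0 j.
  by rewrite mxE; apply: eq_bigr => j _; rewrite !mxE.
under eq_fun => r do rewrite pairE.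
rewrite pairE.
apply: cvg_big => [|j _]; first exact: add_continuous.
apply: cvgM; last exact: ent.
apply: cvg_big => [|i _]; first exact: add_continuous.
by apply: cvgM; exact: ent.
Qed.
End MetricAlongCurves.

(** * Constancy of a parallel metric on parallel fields *)

Section ParallelPairing.
Context {R : realType} {n : nat} {M : topologicalType} {A : atlas R n M}.
Variables (g h : bilinear_field A) (k : nat) (t : nat -> R) (gam : R -> M).
Variables (V W : chart A -> R -> 'rV[R]_n).
Hypotheses (mA : manifold A) (mh : pseudo_riemannian h).
Hypothesis gh : affinely_equivalent g h.
Hypotheses (subt : subdivision k t) (smt : piecewise_smooth A k t gam).
Hypotheses (pV : parallel g k t gam V) (pW : parallel g k t gam W).

Let pairing c s : R := field_pairing h c (gam s) (V c s) (W c s).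

Lemma subdivision_in01 i : (i <= k)%N -> t i \in `[0, 1].
Proof.
case: subt => t0 tk tlt ik.
have mono a b : (a <= b <= k)%N -> t a <= t b.
  elim: b => [|b IH] /andP[]; first by rewrite leqn0 => /eqP ->.
  rewrite leq_eqVlt => /predU1P[->//|ab] bk.
  by apply: le_trans (IH _) (ltW (tlt _ bk)); rewrite -ltnS ab ltnW.
by rewrite in_itv /= -{1}t0 -tk !mono ?leqnn ?ik.
Qed.

Lemma subdivision_piece_in01 i s : (i < k)%N -> s \in `[t i, t i.+1] -> s \in `[0, 1].
Proof.
move=> ik; rewrite !in_itv /= => /andP[is_ si].
have := subdivision_in01 (ltnW ik); have := subdivision_in01 ik.
rewrite !in_itv /= => /andP[_ i1] /andP[i0 _].
by rewrite (le_trans i0 is_) (le_trans si i1).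
Qed.

(** The components of a parallel field are given chart by chart, and no single
    chart need contain the curve; this makes the pairing a function of the time
    alone, which can be studied near each time in any convenient chart. *)
Lemma parallel_pairing_chart c d s : s \in `[0, 1] ->
  chart_dom A c (gam s) -> chart_dom A d (gam s) -> pairing c s = pairing d s.
Proof.
move=> s01 cs ds; rewrite /pairing (metric_change mh cs ds).
by rewrite -(parallel_change pV s01 cs ds) -(parallel_change pW s01 cs ds).
Qed.

(** With w the connection matrix of the velocity, which [g] and [h] share, V' is
    - V w, W' is - W w and the Gram matrix K of [h] has derivative w K + K w^T,
    so the terms of the derivative of V K W^T cancel. *)
Lemma parallel_pairing_derive i c s : (i < k)%N -> s \in `]t i, t i.+1[ ->
  chart_dom A c (gam s) -> is_derive s 1 (pairing c) 0.
Proof.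
move=> ik si cs.
have [U [sigma [Uop tU [sc ssm] gams]]] := smt ik.
have si' : s \in `[t i, t i.+1] by exact: subset_itv_oo_cc.
have Us : U s by exact: tU.
have near_sigma : {near nbhs s, sigma =1 gam}.
  apply: filterS (near_in_itvoo si) => r ri /=.
  by rewrite gams //; exact: subset_itv_oo_cc.
have gc : {for s, continuous gam}.
  by apply: cvg_trans (near_eq_cvg near_sigma) _; rewrite gams //; exact: sc.
have dgam : differentiable (chart_map A c \o gam) s.
  apply/derivable1_diffP; apply: (@near_eq_derivable _ _ _ (chart_map A c \o sigma)).
    by apply: filterS near_sigma => r /= ->.
  apply/derivable1_diffP; apply: (ssm c [::]); split => //=.
  by rewrite -gams.
have dV := parallel_eq pV ik si cs; have dW := parallel_eq pW ik si cs.
have dh := is_derive_gram_along mA mh cs gc dgam.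
have := is_derive_mulmx (is_derive_mulmx dV dh) (is_derive_trmx dW).
move=> /is_derive_mxP /(_ 0 0) /is_derive_eq; apply.
rewrite connection_mx_compatible // !christoffel_formE.
(* The transport equations involve the connection of [g], the derivative of the
   Gram matrix that of [h]. *)
have -> : connection_mx g c (gam s) = connection_mx h c (gam s).
  by rewrite /connection_mx gh.
move: (connection_mx _ _ _ _) => w.
rewrite linearN /= trmx_mul !mulmxDr !mulmxDl !mulmxN !mulNmx !mulmxA.
by rewrite addrAC subrr add0r addNr mxE.
Qed.

(** On a closed piece the pairing is continuous, and its derivative vanishes in
    the interior; the equation of parallel transport says nothing at the break
    points, which is why continuity up to the ends is needed for the mean value
    theorem. *)
Lemma parallel_pairing_piece (ch : R -> chart A) i :
  (forall s, chart_dom A (ch s) (gam s)) -> (i < k)%N ->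
  pairing (ch (t i.+1)) (t i.+1) = pairing (ch (t i)) (t i).
Proof.
move=> chd ik; pose phi s := pairing (ch s) s.
have [_ _ /(_ _ ik) tlt] := subt.
have [U [sigma [Uop tU [sc ssm] gams]]] := smt ik.
suff [x _] : exists2 x, x \in `]t i, t i.+1[ &
    phi (t i.+1) - phi (t i) = 0 * (t i.+1 - t i).
  by rewrite mul0r => /subr0_eq.
apply: (MVT tlt) => [s si|].
  have si' : s \in `[t i, t i.+1] by exact: subset_itv_oo_cc.
  apply: near_eq_is_derive (parallel_pairing_derive ik si (chd s)).
  have near_dom : \forall r \near s, chart_dom A (ch s) (sigma r).
    apply: sc; first exact: tU.
    by rewrite -gams //; apply: open_nbhs_nbhs; split => //; exact: chart_dom_open.
  apply: filterS2 near_dom (near_in_itvoo si) => r cr ri.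
  have ri' : r \in `[t i, t i.+1] by exact: subset_itv_oo_cc.
  by apply: parallel_pairing_chart => //; [exact: subdivision_piece_in01 ik _|rewrite gams].
(* Continuity at s within the piece, in the chart chosen at s. *)
apply/subspace_continuousP => s si.
have Us : U s by exact: tU.
set F := within _ _; have FF : Filter F by exact: within_filter.
have in_itv : \forall r \near F, r \in `[t i, t i.+1].
  exact: withinT.
have near_sigma : {near F, sigma =1 gam}.
  by apply: filterS in_itv => r ri; rewrite gams.
have gc : gam @ F --> gam s.
  apply: cvg_trans (near_eq_cvg near_sigma) _; rewrite gams //.
  exact: cvg_within_filter (sc _ Us).
have near_dom : \forall r \near F, chart_dom A (ch s) (gam r).
  by apply: gc; apply: open_nbhs_nbhs; split => //; exact: chart_dom_open.
have fieldc X : parallel g k t gam X -> X (ch s) @ F --> X (ch s) s.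
  move=> pX; have s01 := subdivision_piece_in01 ik si.
  have /subspace_continuousP/(_ s (conj s01 (chd s))) :=
    parallel_continuous pX (c := ch s).
  apply: cvg_trans => P XP.
  have {}XP : nbhs s [set r | (`[0, 1] `&` gam @^-1` chart_dom A (ch s)) r ->
    P (X (ch s) r)] by exact: XP.
  have : \forall r \near F, chart_dom A (ch s) (gam r) -> r \in `[t i, t i.+1] ->
     P (X (ch s) r).
    apply: cvg_within; apply: filterS XP => r XP cr ri; apply: XP; split => //.
    exact: subdivision_piece_in01 ik _.
  by move=> PP; apply: filterS3 PP near_dom in_itv => r; apply.
have : pairing (ch s) @ F --> phi s.
  apply: field_pairing_cvg; [|exact: fieldc..].
  exact: cvg_comp gc (gram_continuous mA mh (chd s)).
apply: cvg_trans; apply: near_eq_cvg; apply: filterS2 near_dom in_itv => r cr ri.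
by apply: parallel_pairing_chart => //; exact: subdivision_piece_in01 ik _.
Qed.

Lemma parallel_pairing_const c : chart_dom A c (gam 0) -> chart_dom A c (gam 1) ->
  pairing c 1 = pairing c 0.
Proof.
move=> c0 c1; have [ch chd] := choice (fun s => chart_dom_cover mA (gam s)).
have [t0 tk _] := subt.
have step i : (i <= k)%N -> pairing (ch (t i)) (t i) = pairing (ch 0) 0.
  elim: i => [_|i IH ik]; first by rewrite t0.
  by rewrite parallel_pairing_piece // IH // ltnW.
rewrite (@parallel_pairing_chart c (ch 1)) ?in_itv /= ?lexx ?ler01 //.
rewrite (@parallel_pairing_chart c (ch 0)) ?in_itv /= ?lexx ?ler01 //.
by rewrite -{1 2}tk step.
Qed.
End ParallelPairing.

(** * Full holonomy and affinely equivalent metrics *)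

Section Holonomy.
Context {R : realType} {n : nat} {M : topologicalType} {A : atlas R n M}.
Implicit Types (g h : bilinear_field A) (c : chart A).

Lemma mx_bilinear_ext (B C : 'M[R]_n) :
  (forall u v : 'rV[R]_n, (u *m B *m v^T) 0 0 = (u *m C *m v^T) 0 0) -> B = C.
Proof.
move=> BC; apply/matrixP => i j; have := BC (delta_mx 0 i) (delta_mx 0 j).
by rewrite -!rowE !trmx_delta -!colE !mxE.
Qed.

(** Parallel transport of [g] around a loop preserves every metric [h] with the
    same connection, since h(V, W) is constant for parallel fields V and W. *)
Lemma holonomy_group_isometry g h c p P :
  manifold A -> pseudo_riemannian h -> affinely_equivalent g h ->
  chart_dom A c p -> holonomy_group g c p P -> P *m h c p *m P^T = h c p.
Proof.
move=> mA mh gh cp [k [t [gam [subt smt gam0 gam1 lift]]]].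
apply: mx_bilinear_ext => u v; rewrite !mulmxA -mulmxA -trmx_mul.
have [V [pV V0 V1]] := lift u; have [W [pW W0 W1]] := lift v.
have := parallel_pairing_const mA mh gh subt smt pV pW.
move=> /(_ c); rewrite gam0 gam1 V0 V1 W0 W1 => /(_ cp cp).
by rewrite /field_pairing.
Qed.

Lemma so_algebraP g c p X :
  so_algebra g c p X <-> X *m g c p + g c p *m X^T = 0.
Proof.
split=> [soX|].
  apply/eqP; rewrite addr_eq0; apply/eqP/mx_bilinear_ext => u v.
  have := soX u v; rewrite /field_pairing trmx_mul !mulmxA => Xuv.
  by rewrite mulmxN mulNmx [RHS]mxE !mulmxA.
move=> /eqP; rewrite addr_eq0 => /eqP gX u v; rewrite /field_pairing.
by rewrite trmx_mul -(mulmxA u X) gX mulmxN mulNmx [LHS]mxE !mulmxA.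
Qed.

(** Every element of so(g_p) generates isometries of h_p, hence is skew for h_p;
    the symmetric form h_p is then invariant under so(g_p). *)
Lemma full_holonomy_proportional g h c p :
  manifold A -> pseudo_riemannian g -> pseudo_riemannian h ->
  affinely_equivalent g h -> chart_dom A c p ->
  so_algebra g c p `<=` holonomy_algebra g c p -> exists a, h c p = a *: g c p.
Proof.
move=> mA mg mh gh cp full.
have gu := metric_nondegenerate mg cp.
apply: (so_invariant_form (metric_symmetric mg cp) (metric_symmetric mh cp) gu).
move=> X /so_algebraP/full[a [a0 _ aX ahol]].
apply: (stabilizer_generator a0 aX) => r.
exact: holonomy_group_isometry mA mh gh cp (ahol r).
Qed.
End Holonomy.

(** * Spreading proportionality by homogeneity *)

Section Homogeneity.
Context {R : realType} {n : nat} {G : topGroupType} {H : closed_subgroup G}.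
Context {A : atlas R n (coset_space H)}.
Implicit Types (g h : bilinear_field A).

Lemma translation_transitive (p q : coset_space H) : exists a : G, translation a p = q.
Proof.
exists (repr q * (repr p)^-1)%g; rewrite /translation mulgVK.
exact: reprK.
Qed.

(** Take a translation from [p] to [q]; if J is its differential, then
    g_p = J g_q J^T and h_p = J h_q J^T. No inverse translation has to be
    differentiated: J is invertible because g_p is. *)
Lemma invariant_proportional g h c p a : pseudo_riemannian g ->
  G_invariant g -> G_invariant h -> chart_dom A c p -> h c p = a *: g c p ->
  forall d q, chart_dom A d q -> h d q = a *: g d q.
Proof.
move=> mg gi hi cp hg d q dq.
have [b bpq] := translation_transitive p q.
have tdq : chart_dom A d (translation b p) by rewrite bpq.
set J := tangent_mx c d (translation b) p.
have pull f : G_invariant f -> f c p = J *m f d q *m J^T.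
  move=> fi; apply: mx_bilinear_ext => u v; rewrite !mulmxA -[in RHS]mulmxA -trmx_mul.
  by have := fi b c d p cp tdq u v; rewrite bpq.
have Ju : J \in unitmx.
  have := metric_nondegenerate mg cp.
  by rewrite (pull _ gi) -mulmxA unitmx_mul => /andP[].
apply: (can_inj (mulKmx Ju)); apply: (can_inj (mulmxK (_ : J^T \in unitmx))).
  by rewrite unitmx_tr.
by rewrite -pull // hg (pull _ gi) -scalemxAr -scalemxAl.
Qed.
End Homogeneity.

Unset Implicit Arguments.

Theorem theorem2p2 (R : realType) (m n : nat) (G : topGroupType)
    (AG : atlas R m G) (H : closed_subgroup G) (A : atlas R n (coset_space H))
    (g : bilinear_field A) :
  homogeneous_space AG A ->
  connected [set: coset_space H] ->
  (2 <= n)%N ->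
  pseudo_riemannian g ->
  G_invariant g ->
  ~ invariantly_rigid g ->
  forall (p : coset_space H) (c : chart A), chart_dom A c p ->
    holonomy_algebra g c p <> so_algebra g c p.
Proof.
case=> _ mA _ _ n2 mg gi nrigid p c cp full; apply: nrigid => h mh hi gh.
have [|a ha] := full_holonomy_proportional mA mg mh gh cp; first by rewrite full.
exists a; last exact: invariant_proportional mg gi hi cp ha.
(* The zero form on a space of positive dimension is degenerate. *)
apply: contraTneq (metric_nondegenerate mh cp) => a0.
rewrite ha a0 scale0r; case: n n2 {A g mg gi mA p c cp full h mh hi gh ha} => // n' _.
by rewrite unitmxE det0 unitr0.
Qed.
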